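(* Let $X$ be a set, let $I$ be a set of indices, let $j\in I$, and let $\mathcal{L}_X$ be an interlocking nest in $X$. Then $\mathcal{M}=\{\pi_j^{-1}(L) : L\in\mathcal{L}_X\}$ is an interlocking nest in $X^I$.
   Context: A nest on a set is a family of its subsets that is linearly ordered by inclusion. $\pi_j:X^I\to X$ denotes the $j$-th canonical projection. A collection $\mathcal{S}\subset\mathcal{P}(Z)$ of subsets of a set $Z$ is interlocking if for each $T\in\mathcal{S}$ such that $T=\bigcap\{S : T\subset S,\ S\in\mathcal{S}-\{T\}\}$ we have $T=\bigcup\{S : S\subset T,\ S\in\mathcal{S}-\{T\}\}$. *)

(* Defs.v *)
From mathcomp Require Import all_boot mathcomp_extra boolp classical_sets.

Set Implicit Arguments.
Unset Strict Implicit.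
Unset Printing Implicit Defensive.

Local Open Scope classical_set_scope.

Definition nest (Z : Type) (F : set (set Z)) : Prop := total_on F subset.

(* The empty intersection is the ambient set Z, the empty union is set0. *)
Definition interlocking (Z : Type) (F : set (set Z)) : Prop :=
  forall T : set Z, F T ->
    T = \bigcap_(S in [set S | T `<=` S /\ (F `\ T) S]) S ->
    T = \bigcup_(S in [set S | S `<=` T /\ (F `\ T) S]) S.

(* Main.v *)
Require Import Defs.
From mathcomp Require Import all_boot mathcomp_extra boolp classical_sets.

Local Open Scope classical_set_scope.

(** The projection [proj j] is surjective, since a constant function projects
    onto its value. Taking preimages under a surjection [f] reflects inclusion
    ([preimage_subset_surj]), hence is injective, and it commutes with arbitrary
    unions and intersections. So it carries the members of a family lying
    strictly above (or below) [L] exactly onto the members of the preimage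
    family lying strictly above (or below) the preimage of [L]; both the
    hypothesis and the conclusion of the interlocking condition then transfer
    between [L] and its preimage ([interlocking_preimage]). *)

Lemma preimage_subset_surj {Z X : Type} {f : Z -> X} (fsurj : range f = setT)
    (A B : set X) : (f @^-1` A `<=` f @^-1` B) = (A `<=` B).
Proof.
rewrite propeqE; split; last exact: preimage_subset.
by move/(@image_subset _ _ f); rewrite !image_preimage.
Qed.

Lemma preimage_inj_surj {Z X : Type} {f : Z -> X} (fsurj : range f = setT)
    (A B : set X) : f @^-1` A = f @^-1` B -> A = B.
Proof. by rewrite !eqEsubset !preimage_subset_surj. Qed.

(** The predicates [P] and [Q] leave room for the two instances used below,
    inclusion above and inclusion below a given member. *)
Lemma preimage_family_setD1 {Z X : Type} {f : Z -> X} (fsurj : range f = setT)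
    (F : set (set X)) (L : set X) (P : set (set X)) (Q : set (set Z)) :
  (forall S, Q (f @^-1` S) = P S) ->
  [set S | Q S /\ ([set f @^-1` S | S in F] `\ (f @^-1` L)) S] =
  [set f @^-1` S | S in [set S | P S /\ (F `\ L) S]].
Proof.
move=> QP; apply/seteqP; split=> [T [QT [MT]]|_ [S [PS [FS neqSL]] <-]].
  case: MT QT => S FS <- QS neqSL.
  exists S => //; split; first by rewrite -QP.
  by split=> // eqSL; apply: neqSL; rewrite /= eqSL.
split; first by rewrite QP.
by split; [exists S | move/(preimage_inj_surj fsurj)].
Qed.

Lemma nest_preimage {Z X : Type} (f : Z -> X) (F : set (set X)) :
  nest F -> nest [set f @^-1` L | L in F].
Proof.
move=> nestF _ _ [A FA <-] [B FB <-].
by case: (nestF A B FA FB) => AB; [left|right]; exact: preimage_subset.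
Qed.

(** Surjectivity matters: it makes distinct members of [F] have distinct
    preimages, and lets an equation between preimages descend to [X]. *)
Lemma interlocking_preimage {Z X : Type} {f : Z -> X} (fsurj : range f = setT)
    (F : set (set X)) :
  interlocking F -> interlocking [set f @^-1` L | L in F].
Proof.
move=> interF _ [L FL <-].
rewrite (preimage_family_setD1 fsurj F L (fun S => L `<=` S)
  (fun S => f @^-1` L `<=` S)); last by move=> S; rewrite preimage_subset_surj.
rewrite (preimage_family_setD1 fsurj F L (fun S => S `<=` L)
  (fun S => S `<=` f @^-1` L)); last by move=> S; rewrite preimage_subset_surj.
rewrite bigcap_image bigcup_image -preimage_bigcap -preimage_bigcup.
by move/(preimage_inj_surj fsurj)/(interF L FL) => <-.
Qed.

Lemma range_proj {X I : Type} (j : I) :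
  range (proj j : (I -> X) -> X) = setT.
Proof. by apply/seteqP; split=> // x _; exists (fun=> x). Qed.

Theorem theorem9 (X I : Type) (j : I) (LX : set (set X))
    (nestLX : nest LX) (interLX : interlocking LX) :
  let M : set (set (I -> X)) := [set (proj j) @^-1` L | L in LX] in
  nest M /\ interlocking M.
Proof.
split; first exact: nest_preimage.
exact: interlocking_preimage (range_proj j) _ interLX.
Qed.
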